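(* Let $N\ge1$, $L,R>0$, $\gamma\ge0$, $\sigma=\gamma/L$, and let $$u_N^{\mathbb S}(\sigma):=\sqrt{N+1}\cdot\min\Big\{\tau\sigma^2+\nu_\star+\sum_{k=0}^N\nu_k\ :\ \alpha\in\mathbb R_{\ge 0}^N,\ \tau\ge0,\ \nu_\star,\nu_0,\dots,\nu_N\ge0,\ \Lambda(\nu,\tau,\alpha L/R)\succeq0\Big\}.$$ Let $\alpha^*$ denote the $\alpha$-component of an optimal solution of this program. Then any subgradient method with step size schedule $h\in\mathcal H(\alpha^* )$ satisfies $$f(x_{N+1})-f_\star\le\frac{RL}{\sqrt{N+1}}\,u_N^{\mathbb S}(\sigma)$$ for every $f\in\mathcal F$, every choice of subgradients $g_k\in\partial f(x_k)$ and all errors with $\sum_{k=0}^{N-1}\|e_k\|^2\le\gamma^2$.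
   Context: Setting. $X$ is a real Hilbert space, $x_0\in X$. $\mathcal F$ is the class of convex $f:X\to\mathbb R$ all of whose subgradients (at all points) have norm at most $L$ and which attain their minimum $f_\star=f(x_\star)$ at some $x_\star$ with $\|x_\star-x_0\|\le R$. Method. A step size schedule is $h=(h_0,\dots,h_N)$ with $h_0,\dots,h_{N-1}\in[0,\infty)$, $h_N\in[0,\infty]$ and $\sum_i h_i>0$. The method is $x_{k+1}=x_k-h_k\tilde g_k$ with $\tilde g_k=g_k+e_k$, $g_k\in\partial f(x_k)$ for $k=0,\dots,N-1$, and $x_{N+1}=\sum_{k=0}^Nh_kx_k/\sum_{k=0}^Nh_k$. If $h_N=\infty$, then $x_{N+1}=x_N$, and for $k<N$ one reads $h_k/\sum_{i=0}^N h_i=0$ and $\sum_{i=k+1}^Nh_i/\sum_{i=0}^Nh_i=1$. Admissibility. $\mathcal H$ is the set of schedules $h$ for which $\sum_{j=k+1}^N\frac{h_j}{N-k}$ is nondecreasing in $k\in\{0,\dots,N-1\}$ (regarded as true if $h_N=\infty$). For $\alpha\in\mathbb R^N_{\ge 0}$, $\mathcal H(\alpha)$ is the set of $h\in\mathcal H$ with $h_k\cdot\frac{\sum_{i=k+1}^Nh_i}{\sum_{i=0}^Nh_i}=\alpha_k$ for all $k=0,\dots,N-1$. Matrix. For $a=(a_0,\dots,a_{N-1})$, $\Lambda(\nu,\tau,a)$ is the symmetric $(2N+2)\times(2N+2)$ matrix with rows and columns indexed by $\star,0,1,\dots,N,\epsilon_0,\dots,\epsilon_{N-1}$ and entries: $\Lambda_{\star\star}=\nu_\star$;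 $\Lambda_{\star k}=-\frac1{2(N+1)}$ for $0\le k\le N$; $\Lambda_{kk}=\nu_k$ for $0\le k\le N$; $\Lambda_{jk}=\frac{a_j}{2(N-j)}$ for $0\le j<k\le N$; $\Lambda_{\star\epsilon_j}=0$; $\Lambda_{k\epsilon_j}=\frac{a_j}{2(N-j)}$ if $j<k$ and $0$ if $j\ge k$ ($0\le k\le N$, $0\le j\le N-1$); $\Lambda_{\epsilon_j\epsilon_j}=\tau$; $\Lambda_{\epsilon_i\epsilon_j}=0$ for $i\ne j$. Here $\succeq0$ means positive semidefinite, and $\min$ denotes the optimal value (infimum) of the program.
   Formalization: The class F is taken to contain only f that have a subgradient at every point (automatic in finite dimension and for continuous f); otherwise the claim fails, e.g. for f=|l| with l an unbounded linear form, N=1, h_1=∞, x_0=0. *)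

(* Defs.v *)
From HB Require Import structures.
From mathcomp Require Import all_boot all_order all_algebra.
From mathcomp Require Export sesquilinear.
From mathcomp Require Import all_classical all_reals all_analysis.

Set Implicit Arguments.
Unset Strict Implicit.
Unset Printing Implicit Defensive.

Import Order.TTheory GRing.Theory Num.Theory.
Import numFieldNormedType.Exports.

Local Open Scope classical_set_scope.
Local Open Scope ring_scope.

Section Functions.
Context {K : realType} {X : completeNormedModType K}.

(* A real Hilbert space is a complete normed module [X] with an inner product
   [dot] inducing its norm. *)
Definition induces_norm (dot : {dot X for idfun}) :=
  forall x : X, dot x x = `|x| ^+ 2.

Definition subdifferential (dot : {dot X for idfun}) (f : X -> K) (x : X) :
    set X :=
  [set g | forall y : X, f x + dot g (y - x) <= f y].

Definition minimizer (f : X -> K) (xs : X) := forall y : X, f xs <= f y.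

(* The second clause is automatic in finite dimension (and for continuous [f]).
   It excludes the discontinuous convex functions of an infinite-dimensional
   [X], such as [`|l|] for an unbounded linear form [l], whose only subgradient
   at any point is 0, so that a bound on the subgradients says nothing. *)
Definition function_class (dot : {dot X for idfun}) (x0 : X) (L R : K)
    (f : X -> K) :=
  [/\ convex_function [set: convex_lmodType X] f,
      forall x, subdifferential dot f x !=set0,
      forall x g, subdifferential dot f x g -> `|g| <= L
    & exists2 xs, minimizer f xs & `|xs - x0| <= R].

End Functions.

Section Schedules.
Context {K : realType} {N : nat}.
Implicit Types (h : 'I_N.+1 -> \bar K) (alpha : 'I_N -> K).

Local Notation wid := (widen_ord (leqnSn N)).

Definition schedule h :=
  [/\ forall k, (0 <= h k)%E,
      forall k : 'I_N, (h (wid k) < +oo)%E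
    & (0 < \sum_k h k)%E].

(* The [fine] values below are only meaningful in the branches where [h] is
   finite; an infinite last step is governed by the conventions
   h_k / sum_i h_i = 0 and (sum_(i > k) h_i) / sum_i h_i = 1 for k < N. *)
Definition step_tail h (k : 'I_N) : K := \sum_(j < N.+1 | (k < j)%N) fine (h j).

Definition weight h (k : 'I_N.+1) : K :=
  if h ord_max == +oo%E then (k == ord_max)%:R
  else fine (h k) / \sum_i fine (h i).

Definition tail_ratio h (k : 'I_N) : K :=
  if h ord_max == +oo%E then 1 else step_tail h k / \sum_i fine (h i).

Definition admissible h :=
  schedule h /\
  (h ord_max = +oo%E \/
   forall k l : 'I_N, (k <= l)%N ->
     step_tail h k / (N - k)%N%:R <= step_tail h l / (N - l)%N%:R).

Definition admissible_for alpha h :=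
  admissible h /\
  forall k : 'I_N, fine (h (wid k)) * tail_ratio h k = alpha k.

End Schedules.

Section Method.
Context {K : realType} {X : completeNormedModType K} {N : nat}.

Definition subgradient_method (dot : {dot X for idfun}) (f : X -> K) (x0 : X)
    (h : 'I_N.+1 -> \bar K) (g e : 'I_N -> X) (x : 'I_N.+1 -> X) :=
  x ord0 = x0 /\
  forall k : 'I_N,
    subdifferential dot f (x (widen_ord (leqnSn N) k)) (g k) /\
    x (lift ord0 k) = x (widen_ord (leqnSn N) k)
                      - fine (h (widen_ord (leqnSn N) k)) *: (g k + e k).

Definition method_output (h : 'I_N.+1 -> \bar K) (x : 'I_N.+1 -> X) : X :=
  \sum_(k < N.+1) weight h k *: x k.

End Method.

Section Program.
Context {K : realType} {N : nat}.
Implicit Types (alpha a : 'I_N -> K) (tau nus : K) (nu : 'I_N.+1 -> K).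

Definition psd n (M : 'M[K]_n) :=
  M^T = M /\ forall u : 'rV[K]_n, 0 <= (u *m M *m u^T) 0 0.

Definition coupling a (j : 'I_N) : K := a j / (2 * (N - j)%N%:R).

(* Distinct j, k <= N have minn j k < N, so [insub] returns an index of [a]. *)
Definition Lambda_kk nu a : 'M[K]_N.+1 :=
  \matrix_(j, k) if j == k then nu j
                 else oapp (coupling a) 0 (insub (minn j k)).

Definition Lambda_ke a : 'M[K]_(N.+1, N) :=
  \matrix_(k, j) if (j < k)%N then coupling a j else 0.

(* Rows and columns in the order star; 0, ..., N; epsilon_0, ..., epsilon_(N-1).
   [nus] is the entry nu_star. *)
Definition Lambda nus nu tau a : 'M[K]_(1 + N.+1 + N) :=
  let Lambda_sk : 'rV[K]_N.+1 := const_mx (- (2 * N.+1%:R)^-1) in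
  let Lambda_e : 'M[K]_(1 + N.+1, N) := col_mx 0 (Lambda_ke a) in
  block_mx (block_mx nus%:M Lambda_sk Lambda_sk^T (Lambda_kk nu a))
           Lambda_e Lambda_e^T tau%:M.

Definition feasible (L R : K) alpha tau nus nu :=
  [/\ forall j, 0 <= alpha j, 0 <= tau, 0 <= nus, forall k, 0 <= nu k
    & psd (Lambda nus nu tau (fun j => alpha j * L / R))].

Definition objective (sigma : K) tau nus nu : K :=
  tau * sigma ^+ 2 + nus + \sum_k nu k.

Definition optimal (L R sigma : K) alpha tau nus nu :=
  feasible L R alpha tau nus nu /\
  forall alpha' tau' nus' nu', feasible L R alpha' tau' nus' nu' ->
    objective sigma tau nus nu <= objective sigma tau' nus' nu'.

End Program.

Definition uS {K : realType} (N : nat) (L R sigma : K) : K :=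
  Num.sqrt N.+1%:R *
  inf [set v | exists (alpha : 'I_N -> K) tau nus nu,
         feasible L R alpha tau nus nu /\ v = objective sigma tau nus nu].

(* Main.v *)
Require Import Defs.
From mathcomp Require Import all_boot all_order all_algebra.
From mathcomp Require Import all_classical all_reals all_analysis.
From mathcomp Require Import ring lra.
Import Order.TTheory GRing.Theory Num.Theory.
Import numFieldNormedType.Exports.
Local Open Scope ring_scope.

Set Implicit Arguments.
Unset Strict Implicit.
Unset Printing Implicit Defensive.

(** Write q_j = g_j + e_j, let z be the output, gz a subgradient at z, and put
    G_k = g_k for k < N and G_N = gz.  With c_j = alpha_j / (N - j), positive
    semidefiniteness of Lambda, read on the Gram matrix of (x0 - xs) / R, the
    G_k / L and the e_j / L, gives
      1/(N+1) sum_k <x0 - xs, G_k> - sum_(j<k) c_j <q_j, G_k>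
        <= R L (tau sigma^2 + nus + sum_k nu_k)
    ([certificate_bound]).  It remains to see that the left-hand side is at
    least f z - f xs.

    Let s_k be the share of the total step length carried by the steps k, ...,
    N, divided by their number N + 1 - k.  Then c_j = h_j s_(j+1), so the
    left-hand side is the sum over k of <G_k, y_k> where
      y_k = s_0 (x0 - xs) - sum_(j<k) s_(j+1) (x_j - x_(j+1)).
    Summation by parts rewrites y_k, for k < N, as a combination of x_k - xs
    and of the x_k - x_i, i < k, with coefficients s_0 and s_(i+1) - s_i; and
    y_N as a combination of z - xs and of the z - x_i with coefficients s_0
    and mu_i = (N-i) s_i - (N-i-1) s_(i+1).  When these are nonnegative the
    subgradient inequalities bound each <G_k, y_k> from below by the same
    combination of function values, and these add up to f z - f xs
    ([weighted_subgradient_bound]).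

    Nonnegativity of mu_i holds because the tails of the schedule shrink, and
    s_i <= s_(i+1) for i >= 1 is the admissibility of the schedule.
    The inequality s_0 <= s_1 is not part of admissibility; it is here that
    alpha has to be optimal and not only feasible.  If s_1 < s_0, then either
    all the weight sits on the first step, so that z = x0 and alpha = 0, and
    the certificate applied with every G_k equal to gz concludes; or
    c_1 < c_0 ([first_mean_share_drop]).  The latter never happens at an
    optimum ([optimal_coupling_le]): eliminating the star and epsilon variables
    and then u_0 and u_1 from the quadratic form of Lambda by Schur
    complements, one is left with two scalar conditions linked by one
    intermediate parameter, and when c_1 < c_0 moving this parameter lowers
    nu_0 + nu_1 ([coupling_exchange]). *)

(** * One elimination step and the exchange argument *)

Section Elimination.
Context {K : realFieldType}.
Implicit Types (nu c th X : K).

(** The binary quadratic form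
    (nu - th/2) s^2 + (c - th) s t + (th' - th - c^2/(2 tau))/2 t^2
    is nonnegative: this is what remains of the form of Lambda when one
    variable s is eliminated against the sum t of the later ones, th and th'
    being the curvatures along the sum of the variables before and after. *)
Definition elim_step (tau nu c th th' : K) :=
  [/\ 0 <= 2 * nu - th, 0 <= th' - th - c ^+ 2 / (2 * tau)
    & (c - th) ^+ 2 <= (2 * nu - th) * (th' - th - c ^+ 2 / (2 * tau))].

Lemma binary_form_ge0 (a b d : K) : 0 <= a -> 0 <= d -> b ^+ 2 <= a * d ->
  forall s t : K, 0 <= a * s ^+ 2 + 2 * b * s * t + d * t ^+ 2.
Proof.
move=> a0 d0 bad s t.
have [a1|] := ltP 0 a; last first.
  move=> a1; have aE : a = 0 by lra.
  have b0 : b = 0.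
    by apply/eqP; rewrite -sqrf_eq0 eq_le sqr_ge0 andbT; move: bad; rewrite aE mul0r.
  by rewrite aE b0 !(mul0r, mulr0, add0r) mulr_ge0 // sqr_ge0.
rewrite -(pmulr_rge0 _ a1).
have -> : a * (a * s ^+ 2 + 2 * b * s * t + d * t ^+ 2) =
  (a * s + b * t) ^+ 2 + (a * d - b ^+ 2) * t ^+ 2 by ring.
by rewrite addr_ge0 ?sqr_ge0 // mulr_ge0 ?sqr_ge0 // subr_ge0.
Qed.

(** For given th and th', the slack X = 2 nu - th is constrained by a branch of
    a hyperbola once c is free.  The first inequality is a sharpened form of
    the second: its left-hand side forces c = th r / (X + r) as soon as X = 0 or
    the second inequality is an equality. *)
Lemma elim_step_hyperbola (tau nu c th th' : K) : 0 < tau ->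
  elim_step tau nu c th th' ->
  let X := 2 * nu - th in let r := 2 * tau in
  (c * (X + r) - th * r) ^+ 2 <= X * r * ((X + r) * (th' - th) - th ^+ 2) /\
  th ^+ 2 <= (X + r) * (th' - th).
Proof.
move=> t0 [X0 D0 XD] X r.
set D := th' - th - _ in D0 XD.
have r0 : 0 < r by rewrite /r; lra.
have eD : th' - th = D + c ^+ 2 / r by rewrite /D /r; ring.
rewrite eD -/X in X0 XD *.
have e2 : X * r * ((X + r) * (D + c ^+ 2 / r) - th ^+ 2)
   - (c * (X + r) - th * r) ^+ 2 = (X + r) * r * (X * D - (c - th) ^+ 2).
  by field; rewrite gt_eqF.
have e1 : (c * (X + r) - th * r) ^+ 2 <=
   X * r * ((X + r) * (D + c ^+ 2 / r) - th ^+ 2).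
  rewrite -subr_ge0 e2 mulr_ge0 ?subr_ge0 // mulr_ge0 //; lra.
split => //.
have [X1|] := ltP 0 X.
  rewrite -subr_ge0 -(pmulr_rge0 _ (mulr_gt0 X1 r0)).
  exact: le_trans (sqr_ge0 _) e1.
move=> X1; have XE : X = 0 by lra.
have cE : c = th.
  apply/eqP; rewrite -subr_eq0 -sqrf_eq0 eq_le sqr_ge0 andbT.
  by move: XD; rewrite XE mul0r.
rewrite XE cE add0r mulrDr mulrCA divff ?gt_eqF // mulr1 lerDr.
by rewrite mulr_ge0 // ltW.
Qed.

(** The witness c = th r / (X + r), with r = 2 tau, is the coupling forced on
    the hyperbola itself. *)
Lemma hyperbola_elim_step (tau X th th' : K) : 0 < tau -> 0 <= X -> 0 <= th ->
  th ^+ 2 <= (X + 2 * tau) * (th' - th) ->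
  exists2 c, 0 <= c & elim_step tau ((X + th) / 2) c th th'.
Proof.
move=> t0 X0 th0 H; set r := 2 * tau in H *.
have r0 : 0 < r by rewrite /r; lra.
have Xr0 : 0 < X + r by lra.
exists (th * r / (X + r)).
  exact: divr_ge0 (mulr_ge0 th0 (ltW r0)) (ltW Xr0).
have eX : 2 * ((X + th) / 2) - th = X by field.
rewrite /elim_step eX -/r.
set c := th * r / _.
have De : th ^+ 2 * X / (X + r) ^+ 2 <= th' - th - c ^+ 2 / r.
  have e : th ^+ 2 / (X + r) - c ^+ 2 / r = th ^+ 2 * X / (X + r) ^+ 2.
    by rewrite /c; field; rewrite !gt_eqF.
  by rewrite -e lerD2r ler_pdivrMr // mulrC.
split => //.
  by apply: le_trans De; rewrite divr_ge0 ?sqr_ge0 // mulr_ge0 ?sqr_ge0.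
apply: le_trans (ler_wpM2l X0 De).
have -> : (c - th) ^+ 2 = X * (th ^+ 2 * X / (X + r) ^+ 2).
  by rewrite /c; field; rewrite gt_eqF.
by [].
Qed.

(** With X_i = 2 nu_i - th_i, r = 2 tau and p_i = (X_i + r) / th_i, the cost is
    X_0 + X_1 + th_1 up to a constant.  If one of the two hyperbola constraints
    is slack with X_i > 0, lower X_i.  Otherwise c_i p_i = r, so c_1 < c_0 means
    p_0 < p_1.  Then replacing th_1 by th_1 - del costs at most p_1^2 del in X_0
    and saves p_1^2 del in X_1, hence saves del in total. *)
Lemma coupling_exchange (tau nu0 nu1 c0 c1 th0 th1 th2 : K) :
  0 < tau -> 0 < th0 -> c1 < c0 ->
  elim_step tau nu0 c0 th0 th1 -> elim_step tau nu1 c1 th1 th2 ->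
  exists nu0' nu1' c0' c1' th1',
    [/\ elim_step tau nu0' c0' th0 th1', elim_step tau nu1' c1' th1' th2,
        0 <= c0', 0 <= c1' & 0 <= nu0' /\ 0 <= nu1'] /\
    nu0' + nu1' < nu0 + nu1.
Proof.
move=> t0 th0_gt0 c10 S0 S1.
have [H0 Q0] := elim_step_hyperbola t0 S0.
have [H1 Q1] := elim_step_hyperbola t0 S1.
have [X0 D0 _] := S0; have [X1 _ _] := S1.
pose r := 2 * tau; have r0 : 0 < r by rewrite /r; lra.
suff [X0' [X1' [th1' [[X0'0 X1'0 th1'0] Q0' Q1' lt']]]] :
  exists X0' X1' th1', [/\ [/\ 0 <= X0', 0 <= X1' & 0 <= th1'],
     th0 ^+ 2 <= (X0' + r) * (th1' - th0), th1' ^+ 2 <= (X1' + r) * (th2 - th1')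
   & X0' + X1' + th1' < (2 * nu0 - th0) + (2 * nu1 - th1) + th1].
  have [c0' c0'0 S0'] := hyperbola_elim_step t0 X0'0 (ltW th0_gt0) Q0'.
  have [c1' c1'0 S1'] := hyperbola_elim_step t0 X1'0 th1'0 Q1'.
  exists ((X0' + th0) / 2), ((X1' + th1') / 2), c0', c1', th1'.
  by split; [split => //; lra | lra].
move: H0 Q0 H1 Q1 X0 X1; rewrite -/r.
set x0 := 2 * nu0 - th0; set x1 := 2 * nu1 - th1 => H0 Q0 H1 Q1 X0 X1.
have d0_gt0 : 0 < th1 - th0.
  rewrite -(pmulr_rgt0 _ (_ : 0 < x0 + r)); last lra.
  by apply: lt_le_trans Q0; rewrite exprn_gt0.
have th1_gt0 : 0 < th1 by lra.
have d1_gt0 : 0 < th2 - th1.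
  rewrite -(pmulr_rgt0 _ (_ : 0 < x1 + r)); last lra.
  by apply: lt_le_trans Q1; rewrite exprn_gt0.
have improve : forall x t d : K, 0 <= x -> 0 < d ->
    t ^+ 2 <= (x + r) * d -> x * r * ((x + r) * d - t ^+ 2) != 0 ->
    exists2 x', 0 <= x' < x & t ^+ 2 <= (x' + r) * d.
  move=> x t d x_ge0 d_gt0 Q nz.
  have x_gt0 : 0 < x.
    by rewrite lt_def x_ge0 andbT; apply: contra_neq nz => ->; rewrite !mul0r.
  have lt : t ^+ 2 < (x + r) * d.
    by rewrite lt_def Q andbT; apply: contra_neq nz => ->; rewrite subrr mulr0.
  have l2 : t ^+ 2 / d - r < x by rewrite ltrBlDr ltr_pdivrMr.
  exists (Num.max 0 (t ^+ 2 / d - r)).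
    by rewrite le_max lexx /= gt_max x_gt0.
  by rewrite -ler_pdivrMr // -lerBlDr le_max lexx orbT.
have [E0|/(improve _ _ _ X0 d0_gt0 Q0) [x' /andP[x'0 x'l] Q']] :=
   eqVneq (x0 * r * ((x0 + r) * (th1 - th0) - th0 ^+ 2)) 0; last first.
  by exists x', x1, th1; split => //; [split => //; lra | lra].
have [E1|/(improve _ _ _ X1 d1_gt0 Q1) [x' /andP[x'0 x'l] Q']] :=
   eqVneq (x1 * r * ((x1 + r) * (th2 - th1) - th1 ^+ 2)) 0; last first.
  by exists x0, x', th1; split => //; [split => //; lra | lra].
have sq0 : forall a : K, a ^+ 2 <= 0 -> a = 0.
  by move=> a a0; apply/eqP; rewrite -sqrf_eq0 eq_le a0 sqr_ge0.
have C0 : c0 * (x0 + r) = th0 * r.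
  by apply/eqP; rewrite -subr_eq0; apply/eqP/sq0; rewrite (le_trans H0) ?E0.
have C1 : c1 * (x1 + r) = th1 * r.
  by apply/eqP; rewrite -subr_eq0; apply/eqP/sq0; rewrite (le_trans H1) ?E1.
have xr0 : 0 < x0 + r by lra.
have xr1 : 0 < x1 + r by lra.
pose p0 := (x0 + r) / th0; pose p1 := (x1 + r) / th1.
have p0_gt0 : 0 < p0 by rewrite divr_gt0.
have p1_gt0 : 0 < p1 by rewrite divr_gt0.
have e0 : p0 * th0 = x0 + r by rewrite divfK // gt_eqF.
have e1 : p1 * th1 = x1 + r by rewrite divfK // gt_eqF.
have cp0 : c0 * p0 = r.
  by apply: (@mulIf _ th0); rewrite ?gt_eqF // -mulrA e0 C0 mulrC.
have cp1 : c1 * p1 = r.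
  by apply: (@mulIf _ th1); rewrite ?gt_eqF // -mulrA e1 C1 mulrC.
have p01 : p0 < p1.
  have c1_gt0 : 0 < c1 by rewrite -(pmulr_lgt0 _ p1_gt0) cp1.
  rewrite -(ltr_pM2l c1_gt0) cp1 -cp0 ltr_pM2r //.
have x1_gt0 : 0 < x1.
  suff: x0 + r < x1 + r by lra.
  rewrite -e0 -e1; apply: lt_trans (_ : p1 * th0 < _).
    by rewrite ltr_pM2r.
  by rewrite ltr_pM2l //; lra.
have T1 : (x1 + r) * (th2 - th1) = th1 ^+ 2.
  apply: subr0_eq; apply: (mulfI _ (etrans E1 (esym (mulr0 _)))).
  by rewrite mulf_neq0 // gt_eqF.
have e1' : p1 * (th2 - th1) = th1.
  apply: (@mulIf _ th1); rewrite ?gt_eqF //.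
  by rewrite mulrAC e1 T1.
have e0' : x0 + r <= p0 ^+ 2 * (th1 - th0).
  have : th0 <= p0 * (th1 - th0).
    rewrite -(ler_pM2r th0_gt0) mulrAC e0; exact: Q0.
  by rewrite -(ler_pM2l p0_gt0) e0 mulrA.
have pp : 0 < p1 ^+ 2 by rewrite exprn_gt0.
have pp01 : 0 < p1 ^+ 2 - p0 ^+ 2.
  by rewrite subr_gt0 ltr_pXn2r // nnegrE ltW.
(* The four bounds keep, in this order, the constraint on X_0, the one on X_1,
   X_1 >= 0 and th_1 >= 0. *)
pose del := Num.min (Num.min ((th1 - th0) * (p1 ^+ 2 - p0 ^+ 2) / p1 ^+ 2)
   (2 * th1 / (1 + p1 ^+ 2))) (Num.min (x1 / p1 ^+ 2) (th1 / 2)).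
have del0 : 0 < del.
  have p_gt0 : 0 < 1 + p1 ^+ 2 by lra.
  rewrite !lt_min; apply/andP; split; apply/andP; split; apply: divr_gt0 => //.
  + exact: mulr_gt0.
  + exact: mulr_gt0.
have [l1 l2 l3 l4] : [/\ del * p1 ^+ 2 <= (th1 - th0) * (p1 ^+ 2 - p0 ^+ 2),
   del * (1 + p1 ^+ 2) <= 2 * th1, del * p1 ^+ 2 <= x1 & del <= th1 / 2].
  by split; rewrite -?ler_pdivlMr ?addr_gt0 // /del !ge_min lexx ?orbT.
exists (x0 + p1 ^+ 2 * del), (x1 - p1 ^+ 2 * del), (th1 - del).
split; [split|idtac|idtac|]; [|lra|lra| | |lra].
- by rewrite addr_ge0 // mulr_ge0 // ltW.
- apply: le_trans Q0 _; rewrite -subr_ge0.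
  have -> : (x0 + p1 ^+ 2 * del + r) * (th1 - del - th0) - (x0 + r) * (th1 - th0)
   = del * (((th1 - th0) * p1 ^+ 2) - del * p1 ^+ 2 - (x0 + r)) by ring.
  rewrite mulr_ge0 ?(ltW del0) //.
  have : (th1 - th0) * (p1 ^+ 2 - p0 ^+ 2) =
    (th1 - th0) * p1 ^+ 2 - p0 ^+ 2 * (th1 - th0) by ring.
  lra.
- rewrite -subr_ge0.
  have -> : (x1 - p1 ^+ 2 * del + r) * (th2 - (th1 - del)) - (th1 - del) ^+ 2
   = ((x1 + r) * (th2 - th1) - th1 ^+ 2) +
     del * ((x1 + r) - p1 * (p1 * (th2 - th1)) + 2 * th1 - del * (1 + p1 ^+ 2)) by ring.
  rewrite T1 subrr add0r e1' e1 subrr add0r mulr_ge0 ?(ltW del0) // subr_ge0 //.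
Qed.

End Elimination.

(** * Positive semidefinite matrices and Gram matrices *)

Section QuadraticForms.
Context {K : realType}.

Definition gram_sum n (V : Type) (M : 'I_n -> 'I_n -> K) (B : V -> V -> K)
    (v : 'I_n -> V) : K :=
  \sum_i \sum_j M i j * B (v i) (v j).

Definition psd_fun n (M : 'I_n -> 'I_n -> K) :=
  (forall i j, M i j = M j i) /\
  forall u : 'I_n -> K, 0 <= gram_sum M ( *%R ) u.

Lemma psdP n (M : 'M[K]_n) : psd M <-> psd_fun M.
Proof.
have E (u : 'rV[K]_n) : (u *m M *m u^T) 0 0 = gram_sum M ( *%R ) (u 0).
  rewrite mxE /gram_sum exchange_big; apply: eq_bigr => j _ /=.
  rewrite !mxE mulr_suml; apply: eq_bigr => i _; ring.
split=> [[Msym Mge0]|[Msym Mge0]]; split.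
- by move=> i j; rewrite -{1}Msym mxE.
- move=> u; have := Mge0 (\row_i u i); rewrite E.
  by congr (0 <= _); apply: eq_bigr => i _; apply: eq_bigr => j _; rewrite !mxE.
- by apply/matrixP => i j; rewrite mxE.
- by move=> u; rewrite E.
Qed.

(** Otherwise the 2 x 2 principal minor on i, j would be negative. *)
Lemma psd_fun_diag0 n (M : 'I_n -> 'I_n -> K) i j : psd_fun M -> M i i = 0 -> M i j = 0.
Proof.
move=> [Msym Mge0] Mii.
have [<-//|ij] := eqVneq i j.
pose chi (k l : 'I_n) : K := (l == k)%:R.
have dl (F : 'I_n -> K) k : \sum_l F l * chi k l = F k.
  rewrite (bigD1 k) //= /chi eqxx mulr1 big1 ?addr0 // => l /negPf->.
  by rewrite mulr0.
have key t : 0 <= 2 * t * M i j + M j j.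
  have := Mge0 (fun l => chi i l * t + chi j l); rewrite /gram_sum.
  have row l : \sum_m M l m * ((chi i l * t + chi j l) * (chi i m * t + chi j m))
      = (M l i * t * t + M l j * t) * chi i l + (M l i * t + M l j) * chi j l.
    have split m : M l m * ((chi i l * t + chi j l) * (chi i m * t + chi j m)) =
      (M l m * t * (chi i l * t + chi j l)) * chi i m +
      (M l m * (chi i l * t + chi j l)) * chi j m by ring.
    under eq_bigr => m _ do rewrite split.
    by rewrite big_split /= !dl; ring.
  under eq_bigr => l _ do rewrite row.
  by rewrite big_split /= !dl Mii (Msym j i); congr (0 <= _); ring.
apply/eqP/negPn/negP => nz.
have := key (- (M j j + 1) / (2 * M i j)).
have -> : 2 * (- (M j j + 1) / (2 * M i j)) * M i j = - (M j j + 1).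
  by field.
lra.
Qed.

Section Gram.
Context {V : lmodType K} (B : V -> V -> K).
Hypothesis Bsym : forall x y, B x y = B y x.
Hypothesis Blin : forall (a : K) x y z, B (a *: x + y) z = a * B x z + B y z.

Let B0 z : B 0 z = 0.
Proof.
have := Blin 1 0 0 z; rewrite scaler0 addr0 mul1r => /eqP.
by rewrite -subr_eq0 opprD addNKr oppr_eq0 => /eqP.
Qed.

Let Bsum n (a : 'I_n -> K) (v : 'I_n -> V) z :
  B (\sum_i a i *: v i) z = \sum_i a i * B (v i) z.
Proof.
elim/big_rec2: _ => [|i y1 y2 _ IH]; first exact: B0.
by rewrite Blin IH.
Qed.

(** Completing the square in the first vector.  Stated for an arbitrary
    symmetric bilinear form, since it is used both over the scalars, to see
    that the Schur complement is again positive semidefinite, and over the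
    Hilbert space. *)
Lemma gram_sum_recl n (M : 'I_n.+1 -> 'I_n.+1 -> K) (v : 'I_n.+1 -> V) :
  (forall i j, M i j = M j i) -> M ord0 ord0 != 0 ->
  let w := v ord0 + \sum_j (M ord0 (lift ord0 j) / M ord0 ord0) *: v (lift ord0 j) in
  gram_sum M B v = M ord0 ord0 * B w w +
   gram_sum (fun i j => M (lift ord0 i) (lift ord0 j) -
     M ord0 (lift ord0 i) * M ord0 (lift ord0 j) / M ord0 ord0) B (v \o lift ord0).
Proof.
move=> Msym nz w.
pose a := M ord0 ord0; pose b j := M ord0 (lift ord0 j).
pose y := v ord0; pose s := \sum_j (b j / a) *: v (lift ord0 j).
have Bw : B w w = B y y + 2 * B y s + B s s.
  have BD x1 x2 z : B (x1 + x2) z = B x1 z + B x2 z.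
    by rewrite -[x1]scale1r Blin mul1r scale1r.
  rewrite (_ : w = y + s) // BD [B y _]Bsym [B s (y + s)]Bsym !BD [B s y]Bsym.
  ring.
have Bys : \sum_j b j * B y (v (lift ord0 j)) = a * B y s.
  rewrite [B y s]Bsym /s Bsum mulr_sumr; apply: eq_bigr => j _.
  by rewrite Bsym -/(b j) -/a; field.
have Bss : \sum_i \sum_j b i * b j / a * B (v (lift ord0 i)) (v (lift ord0 j)) = a * B s s.
  rewrite /s Bsum mulr_sumr; apply: eq_bigr => i _.
  rewrite -/s Bsym /s Bsum !mulr_sumr; apply: eq_bigr => j _.
  by rewrite Bsym -/(b j) -/(b i) -/a [B (v _) _]Bsym; field.
rewrite /gram_sum big_ord_recl big_ord_recl /= -/a -/y.
under [X in _ + X]eq_bigr => i _ do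
  rewrite big_ord_recl /= Msym -/(b i) [B (v (lift _ _)) y]Bsym.
rewrite big_split /= Bys.
under [X in _ = _ + X]eq_bigr => i _ do
  under eq_bigr => j _ do rewrite mulrBl.
under [X in _ = _ + X]eq_bigr => i _ do rewrite sumrB.
rewrite sumrB Bss Bw; ring.
Qed.

Lemma gram_sum_recl0 n (M : 'I_n.+1 -> 'I_n.+1 -> K) (v : 'I_n.+1 -> V) :
  (forall j, M ord0 j = 0) -> (forall j, M j ord0 = 0) ->
  gram_sum M B v =
   gram_sum (fun i j => M (lift ord0 i) (lift ord0 j)) B (v \o lift ord0).
Proof.
move=> M0j Mj0; rewrite /gram_sum big_ord_recl big1 ?add0r; last first.
  by move=> j _; rewrite M0j mul0r.
by apply: eq_bigr => i _; rewrite big_ord_recl Mj0 mul0r add0r.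
Qed.

End Gram.

(** The trace of the product of two positive semidefinite matrices is
    nonnegative.  Gaussian elimination on M avoids any basis of the span of the
    vectors. *)
Lemma gram_sum_ge0 (V : lmodType K) (B : V -> V -> K)
    (Bsym : forall x y, B x y = B y x)
    (Blin : forall (a : K) x y z, B (a *: x + y) z = a * B x z + B y z)
    (Bge0 : forall x, 0 <= B x x) n (M : 'I_n -> 'I_n -> K) (v : 'I_n -> V) :
  psd_fun M -> 0 <= gram_sum M B v.
Proof.
elim: n M v => [|n IHn] M v psdM; first by rewrite /gram_sum big_ord0.
have [Msym Mge0] := psdM.
have [a0|a_neq0] := eqVneq (M ord0 ord0) 0.
  have M0j j : M ord0 j = 0 by exact: psd_fun_diag0 psdM a0.
  have Mj0 j : M j ord0 = 0 by rewrite Msym.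
  rewrite gram_sum_recl0 //; apply: IHn; split=> // u.
  have := Mge0 (fun i => oapp u 0 (unlift ord0 i)).
  rewrite (@gram_sum_recl0 K^o) //.
  by congr (0 <= _); apply: eq_bigr => i _; apply: eq_bigr => j _; rewrite /= !liftK.
have a_gt0 : 0 < M ord0 ord0.
  rewrite lt_def a_neq0 /=.
  have := Mge0 (fun i => oapp (fun=> 0) 1 (unlift ord0 i)).
  rewrite /gram_sum !big_ord_recl /= unlift_none /= !mulr1.
  rewrite big1 ?addr0 => [|i _]; last by rewrite liftK /= !mulr0.
  rewrite big1 ?addr0 // => i _.
  by rewrite big1 // => j _; rewrite liftK /= mul0r mulr0.
rewrite gram_sum_recl // addr_ge0 ?mulr_ge0 ?(ltW a_gt0) //.
apply: IHn; split=> [i j|u]; first by rewrite Msym; ring.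
(* This value makes the completed square vanish. *)
pose u0 := - \sum_j M ord0 (lift ord0 j) / M ord0 ord0 * u j.
have := Mge0 (fun i => oapp u u0 (unlift ord0 i)).
rewrite (@gram_sum_recl K^o ( *%R )) //; first last.
- by move=> a x y z; rewrite mulrDl -mulrA.
- by move=> x y; rewrite mulrC.
rewrite unlift_none /=.
under [X in u0 + X]eq_bigr => j _ do rewrite liftK.
rewrite addNr mul0r mulr0 add0r.
by congr (0 <= _); apply: eq_bigr => i _; apply: eq_bigr => j _; rewrite /= !liftK.
Qed.

End QuadraticForms.

(** * The quadratic form of Lambda *)

Section CertificateForm.
Context {K : realType} {N : nat}.
Implicit Types (a : 'I_N -> K) (nu : 'I_N.+1 -> K).

Local Notation wid := (widen_ord (leqnSn N)).

Definition star_family (V : Type) (d : V) (u : 'I_N.+1 -> V) (e : 'I_N -> V)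
    (i : 'I_(1 + N.+1 + N)) : V :=
  match fintype.split i with
  | inl i' => match fintype.split i' with inl _ => d | inr k => u k end
  | inr j => e j
  end.

Lemma gram_sum_Lambda_kk (V : Type) (B : V -> V -> K)
    (Bsym : forall x y, B x y = B y x) nu a (u : 'I_N.+1 -> V) :
  gram_sum (Lambda_kk nu a) B u =
  \sum_k nu k * B (u k) (u k) +
  \sum_(j < N) \sum_(k < N.+1 | (j < k)%N)
     a j / (N - j)%N%:R * B (u (wid j)) (u k).
Proof.
pose F (j k : 'I_N.+1) := oapp (coupling a) 0 (insub (j : nat)) * B (u j) (u k).
have rowE j : \sum_k Lambda_kk nu a j k * B (u j) (u k) =
    nu j * B (u j) (u j) + \sum_(k < N.+1 | (j < k)%N) F j k
      + \sum_(k < N.+1 | (k < j)%N) F k j.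
  rewrite (bigD1 j) //= mxE eqxx (bigID (fun k : 'I_N.+1 => (j < k)%N)) /= addrA.
  congr (_ + _ + _); apply: eq_big => k.
  - by rewrite -val_eqE /= neq_ltn; case: (ltngtP k j).
  - by move=> /andP[kj jk]; rewrite mxE eq_sym (negPf kj) (minn_idPl (ltnW jk)).
  - by rewrite -val_eqE /= neq_ltn; case: (ltngtP k j).
  - move=> /andP[kj]; rewrite -leqNgt => jk.
    by rewrite mxE eq_sym (negPf kj) (minn_idPr jk) Bsym.
rewrite /gram_sum; under eq_bigr => j _ do rewrite rowE.
rewrite !big_split /= -addrA; congr (_ + _).
rewrite [X in _ + X](exchange_big_dep predT) //= -big_split /=.
rewrite big_ord_recr /= [X in _ + X](_ : _ = 0) ?addr0; last first.
  rewrite big_pred0 ?big_pred0 ?addr0 // => k; by rewrite ltnNge -ltnS ltn_ord.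
apply: eq_bigr => j _; rewrite -big_split; apply: eq_bigr => k jk /=.
rewrite /F /= insubT ?ltn_ord // => jN.
rewrite (_ : Sub _ _ = j) /=; last exact: val_inj.
rewrite /coupling; field.
by rewrite pnatr_eq0 subn_eq0 -ltnNge jN.
Qed.

Lemma gram_sum_Lambda (V : Type) (B : V -> V -> K)
    (Bsym : forall x y, B x y = B y x) nus nu tau a d (u : 'I_N.+1 -> V) e :
  gram_sum (Lambda nus nu tau a) B (star_family d u e) =
  nus * B d d + \sum_k nu k * B (u k) (u k) + tau * (\sum_j B (e j) (e j))
  - N.+1%:R^-1 * (\sum_k B d (u k))
  + \sum_(j < N) \sum_(k < N.+1 | (j < k)%N)
     a j / (N - j)%N%:R * (B (u (wid j)) (u k) + B (e j) (u k)).
Proof.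
have sl m n (i : 'I_m) : fintype.split (lshift n i) = inl i by exact: (unsplitK (inl i)).
have sr m n (i : 'I_n) : fintype.split (rshift m i) = inr i by exact: (unsplitK (inr i)).
have vl i : star_family d u e (lshift N (lshift N.+1 i)) = d.
  by rewrite /star_family sl sl.
have vu k : star_family d u e (lshift N (rshift 1 k)) = u k.
  by rewrite /star_family sl sr.
have ve j : star_family d u e (rshift _ j) = e j by rewrite /star_family sr.
pose i0 : 'I_(1 + N.+1 + N) := lshift N (lshift N.+1 0).
pose ik k : 'I_(1 + N.+1 + N) := lshift N (rshift 1 k).
pose ie j : 'I_(1 + N.+1 + N) := rshift (1 + N.+1) j.
pose L := Lambda nus nu tau a.
have Lss : L i0 i0 = nus by rewrite /L !block_mxEul mxE eqxx mulr1n.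
have Lsk k : L i0 (ik k) = - (2 * N.+1%:R)^-1.
  by rewrite /L block_mxEul block_mxEur mxE.
have Lks k : L (ik k) i0 = - (2 * N.+1%:R)^-1.
  by rewrite /L block_mxEul block_mxEdl !mxE.
have Lkk j k : L (ik j) (ik k) = Lambda_kk nu a j k.
  by rewrite /L block_mxEul block_mxEdr.
have Lse j : L i0 (ie j) = 0 by rewrite /L block_mxEur col_mxEu mxE.
have Les j : L (ie j) i0 = 0 by rewrite /L block_mxEdl mxE col_mxEu mxE.
have Lke k j : L (ik k) (ie j) = Lambda_ke a k j.
  by rewrite /L block_mxEur col_mxEd.
have Lek j k : L (ie j) (ik k) = Lambda_ke a k j.
  by rewrite /L block_mxEdl mxE col_mxEd.
have Lee i j : L (ie i) (ie j) = tau *+ (i == j) by rewrite /L block_mxEdr mxE.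
have split3 (F : 'I_(1 + N.+1 + N) -> K) :
    \sum_i F i = F i0 + \sum_k F (ik k) + \sum_j F (ie j).
  by rewrite big_split_ord big_split_ord big_ord1.
rewrite /gram_sum -/L split3 split3.
under [X in _ + X + _ = _]eq_bigr => k _ do rewrite split3.
under [X in _ + _ + X = _]eq_bigr => k _ do rewrite split3.
rewrite !big_split /= Lss vl.
have E1 : \sum_k L i0 (ik k) * B d (star_family d u e (ik k))
   = - (2 * N.+1%:R)^-1 * \sum_k B d (u k).
  by rewrite mulr_sumr; apply: eq_bigr => k _; rewrite Lsk vu.
have E2 : \sum_k L (ik k) i0 * B (star_family d u e (ik k)) d
   = - (2 * N.+1%:R)^-1 * \sum_k B d (u k).
  by rewrite mulr_sumr; apply: eq_bigr => k _; rewrite Lks vu Bsym.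
have E3 : \sum_j L i0 (ie j) * B d (star_family d u e (ie j)) = 0.
  by rewrite big1 // => j _; rewrite Lse mul0r.
have E4 : \sum_j L (ie j) i0 * B (star_family d u e (ie j)) d = 0.
  by rewrite big1 // => j _; rewrite Les mul0r.
have E5 : \sum_i \sum_j L (ie i) (ie j) * B (star_family d u e (ie i)) (star_family d u e (ie j))
   = tau * (\sum_j B (e j) (e j)).
  rewrite mulr_sumr; apply: eq_bigr => i _; rewrite (bigD1 i) //= Lee eqxx ve.
  by rewrite big1 ?addr0 // => j /negPf ji; rewrite Lee eq_sym ji mul0r.
have E6 : \sum_j \sum_k L (ie j) (ik k) * B (star_family d u e (ie j)) (star_family d u e (ik k))
   = \sum_(j < N) \sum_(k < N.+1 | (j < k)%N) a j / (N - j)%N%:R / 2 * B (e j) (u k).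
  apply: eq_bigr => j _; rewrite [RHS]big_mkcond; apply: eq_bigr => k _.
  rewrite Lek ve vu mxE; case: ifP => _; last by rewrite mul0r.
  by rewrite /coupling invfM; ring.
have E7 : \sum_k \sum_j L (ik k) (ie j) * B (star_family d u e (ik k)) (star_family d u e (ie j))
   = \sum_(j < N) \sum_(k < N.+1 | (j < k)%N) a j / (N - j)%N%:R / 2 * B (e j) (u k).
  rewrite exchange_big -E6; apply: eq_bigr => j _; apply: eq_bigr => k _.
  by rewrite Lek Lke Bsym.
have E8 : \sum_j \sum_k L (ik j) (ik k) * B (star_family d u e (ik j)) (star_family d u e (ik k))
   = gram_sum (Lambda_kk nu a) B u.
  by apply: eq_bigr => j _; apply: eq_bigr => k _; rewrite Lkk !vu.
rewrite E1 E2 E3 E4 E5 E6 E7 E8 gram_sum_Lambda_kk //.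
have -> : \sum_(j < N) \sum_(k < N.+1 | (j < k)%N)
     a j / (N - j)%N%:R * (B (u (wid j)) (u k) + B (e j) (u k)) =
   \sum_(j < N) \sum_(k < N.+1 | (j < k)%N)
     a j / (N - j)%N%:R * B (u (wid j)) (u k) +
   2 * \sum_(j < N) \sum_(k < N.+1 | (j < k)%N)
     a j / (N - j)%N%:R / 2 * B (e j) (u k).
  rewrite mulr_sumr -big_split; apply: eq_bigr => j _.
  rewrite mulr_sumr -big_split; apply: eq_bigr => k _ /=.
  by move: (a j / _) (B _ _) (B _ _) => p b1 b2; field.
by rewrite invfM; move: (N.+1%:R^-1) => p; field.
Qed.

End CertificateForm.

(** * Eliminating variables from the quadratic form *)

Section ReducedForm.
Context {K : realType}.

Definition cons_ord n (x : K) (v : 'I_n -> K) (k : 'I_n.+1) : K :=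
  oapp v x (unlift ord0 k).

Lemma cons_ord0 n x (v : 'I_n -> K) : cons_ord x v ord0 = x.
Proof. by rewrite /cons_ord unlift_none. Qed.

Lemma cons_ordS n x (v : 'I_n -> K) : cons_ord x v \o lift ord0 = v.
Proof. by apply/funext => k; rewrite /cons_ord /= liftK. Qed.

Definition tail_sum N (u : 'I_N.+1 -> K) (j : 'I_N) : K :=
  \sum_(k < N.+1 | (j < k)%N) u k.

(** The form of Lambda after minimization over the epsilon variables, and
    without its terms in the star variable. *)
Definition reduced_form N (tau : K) (nu : 'I_N.+1 -> K) (c : 'I_N -> K)
    (u : 'I_N.+1 -> K) : K :=
  \sum_k nu k * u k ^+ 2 +
  \sum_(j < N) (c j * u (widen_ord (leqnSn N) j) * tail_sum u j
                - c j ^+ 2 / (4 * tau) * tail_sum u j ^+ 2).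

(** The parameter th is the curvature, along the sum of the variables, of a
    term already eliminated. *)
Definition reduced_ge N (tau : K) (nu : 'I_N.+1 -> K) (c : 'I_N -> K) (th : K) :=
  forall u : 'I_N.+1 -> K, th / 2 * (\sum_k u k) ^+ 2 <= reduced_form tau nu c u.

(** Minimizing over the star variable and over the epsilon variables, which are
    not coupled to each other, turns the form of Lambda into its reduced form. *)
Lemma psd_Lambda_reduced N nus (nu : 'I_N.+1 -> K) tau (a : 'I_N -> K) :
  0 < tau -> 0 < nus ->
  psd (Lambda nus nu tau a) <->
  reduced_ge tau nu (fun j => a j / (N - j)%N%:R)
    ((2 * N.+1%:R ^+ 2 * nus)^-1).
Proof.
move=> tau0 nus0; set c := fun j => _; set th := _^-1.
have N0 : N.+1%:R != 0 :> K by rewrite pnatr_eq0.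
have E d u e : gram_sum (Lambda nus nu tau a) ( *%R ) (star_family d u e) =
   (reduced_form tau nu c u - th / 2 * (\sum_k u k) ^+ 2) +
   nus * (d - (\sum_k u k) / (2 * N.+1%:R * nus)) ^+ 2 +
   \sum_j tau * (e j + c j * tail_sum u j / (2 * tau)) ^+ 2.
  rewrite gram_sum_Lambda; last exact: mulrC.
  have -> : \sum_k d * u k = d * \sum_k u k by rewrite mulr_sumr.
  rewrite /reduced_form.
  rewrite [X in _ = _ + X](eq_bigr (fun j => tau * (e j * e j) + c j * e j * tail_sum u j +
    c j ^+ 2 / (4 * tau) * tail_sum u j ^+ 2)); last first.
    by move=> j _; field; rewrite gt_eqF.
  rewrite !big_split /= sumrN -[\sum_i tau * _]mulr_sumr.
  rewrite [X in _ + X = _](eq_bigr (fun j =>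
    c j * u (widen_ord (leqnSn N) j) * tail_sum u j + c j * e j * tail_sum u j)); last first.
    move=> j _; rewrite /tail_sum !mulr_sumr -big_split.
    by apply: eq_bigr => k _ /=; rewrite -/(c j); ring.
  rewrite big_split /= (eq_bigr (fun k => nu k * u k ^+ 2)); last first.
    by move=> k _; rewrite expr2.
  move: (\sum_(i < N) _ * _ ^+ 2) => S1.
  rewrite /th; move: (N.+1%:R : K) N0 => p p0.
  by field; rewrite p0 !gt_eqF.
rewrite psdP; split=> [[_ H] u|H].
- have := H (star_family ((\sum_k u k) / (2 * N.+1%:R * nus)) u
               (fun j => - (c j * tail_sum u j / (2 * tau)))).
  rewrite E subrr expr0n mulr0 addr0 [X in _ + X]big1 ?addr0 ?subr_ge0 // => j _.
  by rewrite addNr expr0n mulr0.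
- split=> [i j|w]; last first.
    have -> : w = star_family (w (lshift N (lshift N.+1 0)))
        (fun k => w (lshift N (rshift 1 k))) (fun j => w (rshift (1 + N.+1) j)).
      apply/funext => i; rewrite /star_family.
      case: splitP => [i' ii'|j ij]; last by congr (w _); apply: val_inj.
      case: splitP => [i'' ii''|k ik]; congr (w _); apply: val_inj => /=.
        by rewrite ii' ii'' ord1.
      by rewrite ii' ik.
    rewrite E; apply: addr_ge0; first apply: addr_ge0.
    + by rewrite subr_ge0.
    + by rewrite mulr_ge0 ?sqr_ge0 ?ltW.
    + by rewrite sumr_ge0 // => j _; rewrite mulr_ge0 ?sqr_ge0 ?ltW.
  suff symL : (Lambda nus nu tau a)^T = Lambda nus nu tau a by rewrite -{1}symL mxE.
  rewrite /Lambda !tr_block_mx !trmxK !tr_scalar_mx.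
  congr (block_mx (block_mx _ _ _ _) _ _ _).
  apply/matrixP => k l; rewrite !mxE eq_sym minnC.
  by case: eqP => // ->.
Qed.

Lemma reduced_form_recl N tau (nu : 'I_N.+2 -> K) (c : 'I_N.+1 -> K) u :
  let s := \sum_k u (lift ord0 k) in
  reduced_form tau nu c u = nu ord0 * u ord0 ^+ 2 + c ord0 * u ord0 * s
    - c ord0 ^+ 2 / (4 * tau) * s ^+ 2
    + reduced_form tau (nu \o lift ord0) (c \o lift ord0) (u \o lift ord0).
Proof.
move=> s; rewrite /reduced_form [in LHS]big_ord_recl [X in _ + X = _]big_ord_recl.
have -> : tail_sum u ord0 = s.
  by rewrite /tail_sum big_mkcond big_ord_recl /= add0r.
have tl j : tail_sum u (lift ord0 j) = tail_sum (u \o lift ord0) j.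
  rewrite /tail_sum big_mkcond [RHS]big_mkcond big_ord_recl /= add0r.
  by apply: eq_bigr => k _; rewrite /bump !leq0n !add1n ltnS.
have w0 : widen_ord (leqnSn N.+1) ord0 = ord0 by exact: val_inj.
have wl j : widen_ord (leqnSn N.+1) (lift ord0 j) = lift ord0 (widen_ord (leqnSn N) j).
  exact: val_inj.
under [X in _ + (_ + X) = _]eq_bigr => j _ do rewrite tl wl.
by rewrite w0 /=; ring.
Qed.

(** Schur complement in the first variable, which meets the others only through
    their sum; th' is the curvature it leaves along that sum. *)
Lemma elim_reduced_ge N tau (nu : 'I_N.+2 -> K) (c : 'I_N.+1 -> K) th : 0 < tau ->
  reduced_ge tau nu c th <->
  exists2 th', elim_step tau (nu ord0) (c ord0) th th' &
    reduced_ge tau (nu \o lift ord0) (c \o lift ord0) th'.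
Proof.
move=> tau0; pose X := 2 * nu ord0 - th; pose b := c ord0 - th.
have E u : reduced_form tau nu c u - th / 2 * (\sum_k u k) ^+ 2 =
    X / 2 * u ord0 ^+ 2 + b * u ord0 * (\sum_k u (lift ord0 k)) +
    (reduced_form tau (nu \o lift ord0) (c \o lift ord0) (u \o lift ord0)
     - (th / 2 + c ord0 ^+ 2 / (4 * tau)) * (\sum_k u (lift ord0 k)) ^+ 2).
  rewrite reduced_form_recl [\sum_k u k]big_ord_recl /X /b.
  by field; rewrite gt_eqF.
split=> [H|[th' [X0 D0 XD] H'] u]; last first.
  rewrite -subr_ge0 E; have := H' (u \o lift ord0) => /=.
  set s := \sum_k _; set red := reduced_form _ _ _ _ => H''.
  have := @binary_form_ge0 _ X b _ X0 D0 XD (u ord0) s.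
  have -> : (th' - th - c ord0 ^+ 2 / (2 * tau)) * s ^+ 2 =
    th' * s ^+ 2 - 2 * ((th / 2 + c ord0 ^+ 2 / (4 * tau)) * s ^+ 2).
    by field; rewrite gt_eqF.
  lra.
have H2 x v : 0 <= X / 2 * x ^+ 2 + b * x * (\sum_k v k) +
    (reduced_form tau (nu \o lift ord0) (c \o lift ord0) v
     - (th / 2 + c ord0 ^+ 2 / (4 * tau)) * (\sum_k v k) ^+ 2).
  have := H (cons_ord x v); rewrite -subr_ge0 E cons_ord0 cons_ordS.
  by under eq_bigr => k _ do rewrite {1}/cons_ord liftK.
have X_ge0 : 0 <= X.
  have red0 : reduced_form tau (nu \o lift ord0) (c \o lift ord0) (fun=> 0) = 0.
    rewrite /reduced_form big1 ?add0r => [|k _]; last by rewrite expr0n mulr0.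
    by apply: big1 => j _; rewrite /tail_sum big1 // expr0n !mulr0 subr0.
  by have := H2 1 (fun=> 0); rewrite red0 big1 // expr0n expr1n /=; lra.
have b0 : X = 0 -> b = 0.
  move=> X0; apply/eqP/negPn/negP => nb.
  pose v : 'I_N.+1 -> K := fun k => (k == ord0)%:R.
  have v1 : \sum_k v k = 1.
    by rewrite (bigD1 ord0) //= big1 ?addr0 /v ?eqxx // => k /negPf->.
  pose C := reduced_form tau (nu \o lift ord0) (c \o lift ord0) v
     - (th / 2 + c ord0 ^+ 2 / (4 * tau)).
  have e : b * (- (C + 1) / b) = - (C + 1) by field.
  have := H2 (- (C + 1) / b) v; rewrite v1 X0 expr1n !mulr1 -/C e; lra.
(* For X = 0 the last term is 0 by the convention on division, as it should
   be since then b = 0. *)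
exists (th + c ord0 ^+ 2 / (2 * tau) + b ^+ 2 / X).
  split=> //; rewrite -/X -/b.
    rewrite (_ : _ - _ - _ = b ^+ 2 / X); last by ring.
    by rewrite divr_ge0 ?sqr_ge0.
  rewrite (_ : _ - _ - _ = b ^+ 2 / X); last by ring.
  have [/eqP /b0 -> |nX] := boolP (X == 0); first by rewrite expr0n mul0r mulr0.
  by rewrite mulrC divfK.
move=> v; rewrite -subr_ge0; have := H2 (- b * (\sum_k v k) / X) v.
congr (0 <= _); have [/eqP X0 |nX] := boolP (X == 0).
  by rewrite (b0 X0) X0 invr0; field; rewrite gt_eqF.
by field; rewrite nX gt_eqF.
Qed.

End ReducedForm.

(** * Couplings of an optimal certificate *)

Section OptimalCoupling.
Context {K : realType}.

Lemma psd_Lambda_nus_gt0 N nus (nu : 'I_N.+1 -> K) tau (a : 'I_N -> K) :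
  0 <= nus -> psd (Lambda nus nu tau a) -> 0 < nus.
Proof.
rewrite le_eqVlt => /orP[/eqP nus0|//] /psdP psdL.
pose i0 : 'I_(1 + N.+1 + N) := lshift N (lshift N.+1 0).
pose ik : 'I_(1 + N.+1 + N) := lshift N (rshift 1 ord0).
have := psd_fun_diag0 (i := i0) ik psdL.
rewrite !block_mxEul mxE eqxx mulr1n -nus0 block_mxEur mxE => /(_ erefl) /eqP.
by rewrite oppr_eq0 invr_eq0 mulf_eq0 !pnatr_eq0.
Qed.

Lemma psd_Lambda_tau_gt0 N nus (nu : 'I_N.+1 -> K) tau (a : 'I_N -> K) j :
  0 <= tau -> a j != 0 -> psd (Lambda nus nu tau a) -> 0 < tau.
Proof.
rewrite le_eqVlt => /orP[/eqP tau0|//] aj /psdP psdL.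
pose ie : 'I_(1 + N.+1 + N) := rshift (1 + N.+1) j.
pose ik : 'I_(1 + N.+1 + N) := lshift N (rshift 1 ord_max).
have := psd_fun_diag0 (i := ie) ik psdL.
rewrite block_mxEdr mxE eqxx mulr1n -tau0 block_mxEdl mxE col_mxEd mxE ltn_ord.
move=> /(_ erefl) /eqP; rewrite /coupling mulf_eq0 invr_eq0 mulf_eq0 !pnatr_eq0.
by rewrite (negPf aj) /= subn_eq0 leqNgt ltn_ord.
Qed.

(** Only the first two couplings are compared.  If the first were larger, both
    of their variables could be eliminated and [coupling_exchange] would give
    a cheaper certificate with the same later entries. *)
Lemma optimal_coupling_le N (L R sigma : K) (alpha : 'I_N.+2 -> K) tau nus nu :
  0 < L -> 0 < R -> optimal L R sigma alpha tau nus nu ->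
  alpha ord0 / N.+2%:R <= alpha (lift ord0 ord0) / N.+1%:R.
Proof.
move=> L0 R0 [[alpha0 tau_ge0 nus_ge0 nu_ge0 psdL] opt].
rewrite leNgt; apply/negP => lt10.
pose a j := alpha j * L / R; pose c j := a j / (N.+2 - j)%N%:R.
have nus0 := psd_Lambda_nus_gt0 nus_ge0 psdL.
have LR0 : 0 < L / R by rewrite divr_gt0.
have c10 : c (lift ord0 ord0) < c ord0.
  have cE j : c j = L / R * (alpha j / (N.+2 - j)%N%:R).
    by rewrite /c /a; move: (_%:R^-1) (R^-1) => p q; ring.
  by rewrite !cE ltr_pM2l // lift0 subSS !subn0.
have a_neq0 : a ord0 != 0.
  apply: contraTneq lt10 => /eqP; rewrite /a -mulrA mulf_eq0 (gt_eqF LR0) orbF.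
  by move/eqP => ->; rewrite mul0r -leNgt divr_ge0.
have tau0 := psd_Lambda_tau_gt0 tau_ge0 a_neq0 psdL.
move: psdL; rewrite psd_Lambda_reduced // -/c.
set th0 := _^-1 => red0.
have th0_gt0 : 0 < th0 by rewrite invr_gt0 !mulr_gt0 // exprn_gt0.
have [th1 step0 red1] := (elim_reduced_ge nu c th0 tau0).1 red0.
have [th2 step1 red2] := (elim_reduced_ge _ _ th1 tau0).1 red1.
have [nu0' [nu1' [c0' [c1' [th1' [[step0' step1' c0'0 c1'0 [nu0'0 nu1'0]] lt]]]]]] :=
  coupling_exchange tau0 th0_gt0 c10 step0 step1.
pose nu' := cons_ord nu0' (cons_ord nu1' (nu \o lift ord0 \o lift ord0)).
pose c' := cons_ord c0' (cons_ord c1' (c \o lift ord0 \o lift ord0)).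
have red0' : reduced_ge tau nu' c' th0.
  apply: (elim_reduced_ge _ _ _ tau0).2; exists th1'; rewrite /nu' /c' ?cons_ord0 ?cons_ordS //.
  by apply: (elim_reduced_ge _ _ _ tau0).2; exists th2; rewrite ?cons_ord0 ?cons_ordS.
have cons_ge0 n x (v : 'I_n -> K) : 0 <= x -> (forall k, 0 <= v k) ->
    forall k, 0 <= cons_ord x v k.
  by move=> x0 v0 k; rewrite /cons_ord; case: unlift => [k'|] /=.
have c'_ge0 : forall j, 0 <= c' j.
  do 2 apply: (cons_ge0) => //; move=> j /=.
  by rewrite /c /a !divr_ge0 ?mulr_ge0 ?(ltW L0) ?(ltW R0).
pose alpha' j := c' j * (N.+2 - j)%N%:R / (L / R).
have : objective sigma tau nus nu <= objective sigma tau nus nu'.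
  apply: (opt alpha'); split=> //.
  - move=> j; rewrite /alpha'. apply: divr_ge0; [exact: mulr_ge0|exact: ltW].
  - by apply: (cons_ge0) => //; apply: (cons_ge0) => // j; apply: nu_ge0.
  - rewrite psd_Lambda_reduced // (_ : (fun j => _) = c') //.
    apply/funext => j; rewrite /alpha'.
    have : (N.+2 - j)%:R != 0 :> K by rewrite pnatr_eq0 subn_eq0 -ltnNge ltn_ord.
    move: (_%:R) => m m0; field.
    by rewrite m0 !gt_eqF.
rewrite /objective lerD2l [leRHS]big_ord_recl [leLHS]big_ord_recl.
rewrite [X in _ + X <= _]big_ord_recl [X in _ <= _ + X]big_ord_recl /=.
rewrite /nu' cons_ord0.
have e1 k : cons_ord nu0' (cons_ord nu1' (nu \o lift ord0 \o lift ord0)) (lift ord0 k)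
   = cons_ord nu1' (nu \o lift ord0 \o lift ord0) k.
  by rewrite {1}/cons_ord liftK.
have e2 k : cons_ord nu1' (nu \o lift ord0 \o lift ord0) (lift ord0 k)
   = nu (lift ord0 (lift ord0 k)).
  by rewrite {1}/cons_ord liftK.
rewrite e1 cons_ord0; under [X in _ <= _ + (_ + X)]eq_bigr => k _ do rewrite e1 e2.
by rewrite !addrA lerD2r leNgt lt.
Qed.

End OptimalCoupling.

(** * Weights on the subgradient inequalities *)

Section Multipliers.
Context {K : realFieldType}.
Implicit Types (q s x F : nat -> K).

Lemma summation_by_parts q x k :
  \sum_(i < k) (q i.+1 - q i) * (x i - x k) =
  \sum_(j < k) (q j.+1 - q 0%N) * (x j - x j.+1).
Proof.
elim: k => [|k IHk]; first by rewrite !big_ord0.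
rewrite !big_ord_recr /= -IHk.
have tel : \sum_(i < k) (q i.+1 - q i) = q k - q 0%N.
  by rewrite -(big_mkord xpredT (fun i => q i.+1 - q i)) telescope_sumr.
rewrite (eq_bigr (fun i : 'I_k => (q i.+1 - q i) * (x i - x k) +
   (q i.+1 - q i) * (x k - x k.+1))); last by move=> i _; ring.
rewrite big_split /= -mulr_suml tel; ring.
Qed.

Lemma sum_steps x k : \sum_(j < k) (x j - x j.+1) = x 0%N - x k.
Proof.
rewrite -(big_mkord xpredT (fun j => x j - x j.+1)).
by rewrite -[RHS]opprB -(telescope_sumr x (leq0n k)) -sumrN; apply: eq_bigr => i _; rewrite opprB.
Qed.

(** With x i the pairing of the i-th iterate with the subgradient G_k, this
    writes <G_k, y_k> through the differences that occur in the subgradient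
    inequalities at the k-th iterate. *)
Lemma iterate_combination s x xs k :
  s 0%N * (x 0%N - xs) - \sum_(j < k) s j.+1 * (x j - x j.+1) =
  s 0%N * (x k - xs) + \sum_(i < k) (s i.+1 - s i) * (x k - x i).
Proof.
have e1 := summation_by_parts s x k.
have e2 := sum_steps x k.
have e3 : \sum_(i < k) (s i.+1 - s i) * (x k - x i) =
    - \sum_(i < k) (s i.+1 - s i) * (x i - x k).
  by rewrite -sumrN; apply: eq_bigr => i _; ring.
have e4 : \sum_(j < k) (s j.+1 - s 0%N) * (x j - x j.+1) =
    \sum_(j < k) s j.+1 * (x j - x j.+1) - s 0%N * (x 0%N - x k).
  by rewrite -e2 mulr_sumr -sumrB; apply: eq_bigr => i _; ring.
rewrite e3 e1 e4; ring.
Qed.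

Definition tail_weight N s (i : nat) : K := (N.+1%:R - i%:R) * s i.

(** The weight given to the subgradient inequality between the output and the
    i-th iterate. *)
Definition output_multiplier N s (i : nat) : K :=
  (N%:R - i%:R) * s i - (N%:R - i.+1%:R) * s i.+1.

(** The output z is an average of the iterates with weights the differences of
    the tail weights; three summations by parts, for these weights, for the
    multipliers and for the steps, express both sides through the same sums. *)
Lemma output_combination N s x xs z : N.+1%:R * s 0%N = 1 ->
  z = x N + \sum_(i < N) (tail_weight N s i - tail_weight N s i.+1) * (x i - x N) ->
  s 0%N * (x 0%N - xs) - \sum_(j < N) s j.+1 * (x j - x j.+1) =
  s 0%N * (z - xs) + \sum_(i < N) output_multiplier N s i * (z - x i).
Proof.
move=> s0E zE.
pose q i : K := - ((N%:R - i%:R) * s i).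
pose A := \sum_(j < N) (N%:R - j%:R) * s j.+1 * (x j - x j.+1).
pose C := \sum_(j < N) s j.+1 * (x j - x j.+1).
have e0 := sum_steps x N.
have eq : \sum_(i < N) output_multiplier N s i * (x i - x N) =
   N%:R * s 0%N * (x 0%N - x N) - (A - C).
  rewrite (eq_bigr (fun i : 'I_N => (q i.+1 - q i) * (x i - x N))); last first.
    by move=> i _; rewrite /q /output_multiplier; ring.
  rewrite summation_by_parts -e0 mulr_sumr /A /C -!sumrB; apply: eq_bigr => j _.
  by rewrite /q -natr1; ring.
have er : \sum_(i < N) (tail_weight N s i - tail_weight N s i.+1) * (x i - x N)
    = x 0%N - x N - A.
  rewrite (eq_bigr (fun i : 'I_N => - ((tail_weight N s i.+1 - tail_weight N s i) * (x i - x N)))); last first.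
    by move=> i _; ring.
  rewrite sumrN summation_by_parts -e0 /A -sumrB -sumrN; apply: eq_bigr => j _.
  have -> : tail_weight N s 0%N = 1 by rewrite /tail_weight subr0.
  have -> : tail_weight N s j.+1 = (N%:R - j%:R) * s j.+1.
    by rewrite /tail_weight -!natr1; ring.
  by ring.
have em : \sum_(i < N) output_multiplier N s i = N%:R * s 0%N.
  rewrite -(big_mkord xpredT (output_multiplier N s)).
  rewrite (eq_bigr (fun i => q i.+1 - q i)); last first.
    by move=> i _; rewrite /q /output_multiplier; ring.
  by rewrite telescope_sumr // /q subrr subr0; ring.
have es : \sum_(i < N) output_multiplier N s i * (z - x i) =
    N%:R * s 0%N * (z - x N) - \sum_(i < N) output_multiplier N s i * (x i - x N).
  by rewrite -em mulr_suml -sumrB; apply: eq_bigr => i _; ring.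
rewrite es eq -/C.
have {}zE : z - x N = x 0%N - x N - A by rewrite zE er; ring.
have s0N : N%:R * s 0%N = 1 - s 0%N.
  by move: s0E; rewrite -natr1 mulrDl mul1r; lra.
have -> : z - xs = (z - x N) + (x N - xs) by ring.
rewrite zE s0N; ring.
Qed.

(** For n = N the coefficient of F_i on the right is [output_multiplier N s i]:
    what the inequalities at the iterates leave of f x_i is exactly what the
    inequalities at the output absorb. *)
Lemma multiplier_balance s F n :
  \sum_(k < n) (s 0%N * F k + \sum_(i < k) (s i.+1 - s i) * (F k - F i)) =
  \sum_(i < n) (s i - (n%:R - i.+1%:R) * (s i.+1 - s i)) * F i.
Proof.
elim: n => [|n IHn]; first by rewrite !big_ord0.
rewrite !big_ord_recr /= IHn.
have tel : \sum_(i < n) (s i.+1 - s i) = s n - s 0%N.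
  by rewrite -(big_mkord xpredT (fun i => s i.+1 - s i)) telescope_sumr.
have -> : \sum_(i < n) (s i.+1 - s i) * (F n - F i) =
    (s n - s 0%N) * F n - \sum_(i < n) (s i.+1 - s i) * F i.
  by rewrite -tel mulr_suml -sumrB; apply: eq_bigr => i _; ring.
rewrite [in RHS](eq_bigr (fun i : 'I_n =>
    (s i - (n%:R - i.+1%:R) * (s i.+1 - s i)) * F i - (s i.+1 - s i) * F i)); last first.
  by move=> i _; rewrite -natr1; ring.
rewrite sumrB subrr; ring.
Qed.

(** With m = N - i, the hypothesis m s_(i+1) <= (m+1) s_i yields
    m mu_i >= m^2 s_i - (m-1) (m+1) s_i = s_i. *)
Lemma output_multiplier_ge0 N s i : (i < N)%N ->
  0 <= s i -> tail_weight N s i.+1 <= tail_weight N s i ->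
  0 <= output_multiplier N s i.
Proof.
rewrite /tail_weight /output_multiplier => iN si le.
pose m : K := N%:R - i%:R.
have m1 : 1 <= m by rewrite /m -natrB ?(ltnW iN) // ler1n subn_gt0.
have m0 : 0 < m by lra.
have e1 : N.+1%:R - i%:R = m + 1 :> K by rewrite /m -natr1; ring.
have e2 : N.+1%:R - i.+1%:R = m :> K by rewrite /m -!natr1; ring.
have e3 : N%:R - i.+1%:R = m - 1 :> K by rewrite /m -natr1; ring.
rewrite e1 e2 in le; rewrite e3 -/m -(pmulr_rge0 _ m0).
have : (m - 1) * (m * s i.+1) <= (m - 1) * ((m + 1) * s i).
  by rewrite ler_wpM2l // subr_ge0.
have -> : m * (m * s i - (m - 1) * s i.+1) =
  s i + ((m - 1) * ((m + 1) * s i) - (m - 1) * (m * s i.+1)) by ring.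
lra.
Qed.

(** Here x k i stands for <G_k, x_i>, xs k for <G_k, xs>, and row N belongs to
    the subgradient at the output, whose pairing with the output is z; the
    hypotheses on F, Fz, Fs are the subgradient inequalities used. *)
Lemma weighted_subgradient_bound N s F Fz Fs (x : nat -> nat -> K) (xs : nat -> K) z :
  N.+1%:R * s 0%N = 1 ->
  (forall i, (i < N)%N -> 0 <= s i) ->
  (forall i, (i.+1 < N)%N -> s i <= s i.+1) ->
  (forall i, (i < N)%N -> tail_weight N s i.+1 <= tail_weight N s i) ->
  z = x N N + \sum_(i < N) (tail_weight N s i - tail_weight N s i.+1) * (x N i - x N N) ->
  (forall k, (k < N)%N -> F k + (xs k - x k k) <= Fs) ->
  (forall i k, (k < N)%N -> F k + (x k i - x k k) <= F i) ->
  Fz + (xs N - z) <= Fs ->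
  (forall i, Fz + (x N i - z) <= F i) ->
  Fz - Fs <= \sum_(k < N.+1)
    (s 0%N * (x k 0%N - xs k) - \sum_(j < k) s j.+1 * (x k j - x k j.+1)).
Proof.
move=> s0E s_ge0 s_incr tw zE Hs Hi Hzs Hzi.
have s0 : 0 <= s 0%N.
  by rewrite -(pmulr_rge0 _ (_ : 0 < N.+1%:R)) // s0E ler01.
rewrite big_ord_recr /= (output_combination (xs N) s0E zE).
have rows : \sum_(k < N) (s 0%N * (F k - Fs) + \sum_(i < k) (s i.+1 - s i) * (F k - F i))
   <= \sum_(k < N) (s 0%N * (x k 0%N - xs k) - \sum_(j < k) s j.+1 * (x k j - x k j.+1)).
  apply: ler_sum => k _; rewrite iterate_combination lerD //.
    by rewrite ler_wpM2l //; have := Hs k (ltn_ord k); lra.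
  apply: ler_sum => i _; rewrite ler_wpM2l ?subr_ge0 ?s_incr //.
    by rewrite (leq_ltn_trans _ (ltn_ord k)).
  by have := Hi i k (ltn_ord k); lra.
have lastrow : s 0%N * (Fz - Fs) + \sum_(i < N) output_multiplier N s i * (Fz - F i)
   <= s 0%N * (z - xs N) + \sum_(i < N) output_multiplier N s i * (z - x N i).
  rewrite lerD //; first by rewrite ler_wpM2l //; lra.
  apply: ler_sum => i _; rewrite ler_wpM2l //; last by have := Hzi i; lra.
  by apply: output_multiplier_ge0; rewrite ?s_ge0 ?tw.
apply: le_trans (lerD rows lastrow); rewrite le_eqVlt; apply/orP; left; apply/eqP.
have := multiplier_balance s (fun i => F i - Fz) N.
rewrite (eq_bigr (fun k : 'I_N => (s 0%N * (F k - Fs) +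
    \sum_(i < k) (s i.+1 - s i) * (F k - F i)) + s 0%N * (Fs - Fz))); last first.
  move=> k _; rewrite (eq_bigr (fun i : 'I_k => (s i.+1 - s i) * (F k - F i))).
    by ring.
  by move=> i _; ring.
rewrite big_split /= sumr_const card_ord.
rewrite [in RHS](eq_bigr (fun i : 'I_N => - (output_multiplier N s i * (Fz - F i)))); last first.
  by move=> i _; rewrite /output_multiplier -natr1; ring.
rewrite sumrN => e.
have s0N : N%:R * s 0%N = 1 - s 0%N.
  by move: s0E; rewrite -natr1 mulrDl mul1r; lra.
rewrite -[_ *+ N]mulr_natl mulrA s0N in e.
move: e; set S1 := \sum_(k < N) _; set S2 := \sum_(k < N) _ => e.
have -> : S1 = - S2 - (1 - s 0%N) * (Fs - Fz) by rewrite -e; ring.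
ring.
Qed.

End Multipliers.

(** * The certificate in the Hilbert space *)

Section Certificate.
Context {K : realType} {X : completeNormedModType K}.
Variable dot : {dot X for idfun}.
Hypothesis dotE : induces_norm dot.

Lemma dot_sym x y : dot x y = dot y x.
Proof. by rewrite hermC expr0 mul1r. Qed.

Lemma dot_lin (a : K) x y z : dot (a *: x + y) z = a * dot x z + dot y z.
Proof. by rewrite linearDl linearZl_LR. Qed.

Lemma certificate_bound N (L R gamma : K) (alpha : 'I_N -> K) tau nus nu
    d (G : 'I_N.+1 -> X) (e : 'I_N -> X) :
  0 < L -> 0 < R -> feasible L R alpha tau nus nu ->
  `|d| <= R -> (forall k, `|G k| <= L) ->
  \sum_(j < N) `|e j| ^+ 2 <= gamma ^+ 2 ->
  N.+1%:R^-1 * (\sum_k dot d (G k)) -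
  \sum_(j < N) \sum_(k < N.+1 | (j < k)%N) alpha j / (N - j)%N%:R *
     dot (G (widen_ord (leqnSn N) j) + e j) (G k)
  <= R * L * objective (gamma / L) tau nus nu.
Proof.
move=> L0 R0 [_ tau0 nus0 nu0 psdL] dR GL eg.
have dot_ge0 x : 0 <= dot x x by rewrite dotE sqr_ge0.
have := gram_sum_ge0 dot_sym dot_lin dot_ge0
  (star_family (R^-1 *: d) (fun k => L^-1 *: G k) (fun j => L^-1 *: e j))
  ((psdP _).1 psdL).
rewrite gram_sum_Lambda; last exact: dot_sym.
have dotZ a b x y : dot (a *: x) (b *: y) = a * b * dot x y.
  by rewrite linearZl_LR linearZr_LR /= mulrA.
have sq (x : X) (a b : K) : 0 < b -> `|x| <= b -> 0 <= a ->
    a * dot (b^-1 *: x) (b^-1 *: x) <= a.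
  move=> b0 xb a0; rewrite -[leRHS]mulr1 ler_wpM2l // dotZ dotE.
  rewrite -expr2 -exprMn exprn_ile1 ?mulr_ge0 ?invr_ge0 ?(ltW b0) //.
  by rewrite mulrC ler_pdivrMr // mul1r.
have H1 := sq _ _ _ R0 dR nus0.
have H2 : \sum_k nu k * dot (L^-1 *: G k) (L^-1 *: G k) <= \sum_k nu k.
  by apply: ler_sum => k _; apply: sq.
have H3 : tau * \sum_j dot (L^-1 *: e j) (L^-1 *: e j) <= tau * (gamma / L) ^+ 2.
  rewrite ler_wpM2l // exprMn exprVn (eq_bigr (fun j => L ^- 2 * `|e j| ^+ 2)).
    by rewrite -mulr_sumr mulrC ler_wpM2r // invr_ge0 exprn_ge0 // ltW.
  by move=> j _; rewrite dotZ dotE -invfM expr2.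
have H4 : \sum_k dot (R^-1 *: d) (L^-1 *: G k) = (R * L)^-1 * \sum_k dot d (G k).
  by rewrite mulr_sumr; apply: eq_bigr => k _; rewrite dotZ invfM.
rewrite [X in _ + X](_ : _ = (R * L)^-1 * \sum_(j < N) \sum_(k < N.+1 | (j < k)%N)
     alpha j / (N - j)%N%:R * dot (G (widen_ord (leqnSn N) j) + e j) (G k)); last first.
  rewrite mulr_sumr; apply: eq_bigr => j _.
  rewrite mulr_sumr; apply: eq_bigr => k _.
  rewrite !dotZ linearDl /=; move: (_%:R^-1) => p; field.
  by rewrite !gt_eqF.
rewrite H4; set S1 := \sum_k dot d _; set S2 := \sum_(j < N) \sum_(k < N.+1 | _) _.
move=> H.
have RL : 0 < R * L by rewrite mulr_gt0.
rewrite [R * L * _]mulrC -ler_pdivrMr // /objective.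
have -> : (N.+1%:R^-1 * S1 - S2) / (R * L) = N.+1%:R^-1 * ((R * L)^-1 * S1) - (R * L)^-1 * S2.
  by move: (N.+1%:R^-1) ((R * L)^-1) => p q; ring.
apply: le_trans (lerD (lerD H3 H1) H2); move: H.
move: (nus * _) (\sum_k nu k * _) (tau * _) (_^-1 * (_ * S1)) (_ * S2).
by move=> a b c p q; lra.
Qed.

End Certificate.

(** * Tail shares of a schedule *)

Section TailShares.
Context {K : realType} {N : nat}.
Variable h : 'I_N.+1 -> \bar K.

Local Notation wid := (widen_ord (leqnSn N)).
Local Notation S := (\sum_i fine (h i)).

(** The limit as the last step tends to infinity of the share of the steps k,
    ..., N is 1 for every k <= N. *)
Definition tail_share (k : nat) : K :=
  if h ord_max == +oo%E then (k <= N)%:R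
  else (\sum_(j < N.+1 | (k <= j)%N) fine (h j)) / S.

(** For a finite schedule, admissibility says that these averages are
    nondecreasing from k = 1 to k = N. *)
Definition mean_share (k : nat) : K := tail_share k / (N.+1 - k)%N%:R.

Lemma tail_ratioE (k : 'I_N) : tail_ratio h k = tail_share k.+1.
Proof. by rewrite /tail_ratio /tail_share ltn_ord. Qed.

Lemma weightE (k : 'I_N.+1) : weight h k = tail_share k - tail_share k.+1.
Proof.
rewrite /weight /tail_share; case: ifP => _.
  have := ltn_ord k; rewrite -val_eqE ltnS /=.
  by case: ltngtP => //= _ _; rewrite ?subr0 ?subrr.
rewrite -mulrBl; congr (_ / _).
rewrite (bigD1 k) //= [X in _ + X - _](eq_bigl (fun j : 'I_N.+1 => (k < j)%N)) ?addrK //.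
by move=> j; rewrite ltn_neqAle andbC -val_eqE eq_sym.
Qed.

Lemma tail_weight_mean_share k : (k <= N)%N ->
  tail_weight N mean_share k = tail_share k.
Proof.
move=> kN; rewrite /tail_weight /mean_share -natrB ?(leqW kN) // mulrC divfK //.
by rewrite pnatr_eq0 subn_eq0 -ltnNge.
Qed.

Hypothesis sched : schedule h.

Lemma fine_step_ge0 k : 0 <= fine (h k).
Proof. by case: sched => h0 _ _; exact: fine_ge0. Qed.

Lemma step_sum_gt0 : h ord_max != +oo%E -> 0 < S.
Proof.
case: sched => h0 hfin hS hN.
have hf k : h k \is a fin_num.
  rewrite ge0_fin_numE //; have [kN|] := ltnP k N.
    by rewrite (_ : k = wid (Ordinal kN)) //; exact: val_inj.
  move=> Nk; rewrite (_ : k = ord_max) ?ltey //.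
  by apply: val_inj; apply/eqP; rewrite eqn_leq Nk -ltnS ltn_ord.
rewrite -lte_fin -sumEFin; move: hS; congr (_ < _)%E.
by apply: eq_bigr => k _; rewrite fineK.
Qed.

Lemma tail_share0 : tail_share 0 = 1.
Proof.
by rewrite /tail_share; case: ifPn => // hN; rewrite divff ?gt_eqF ?step_sum_gt0.
Qed.

Lemma tail_share_ge0 k : 0 <= tail_share k.
Proof.
rewrite /tail_share; case: ifPn => // hN.
by rewrite divr_ge0 ?sumr_ge0 // => i _; exact: fine_step_ge0.
Qed.

Lemma mean_share_ge0 k : 0 <= mean_share k.
Proof. by rewrite divr_ge0 ?tail_share_ge0. Qed.

Lemma mean_share0 : N.+1%:R * mean_share 0 = 1.
Proof. by rewrite /mean_share tail_share0 subn0 mulrC divfK // pnatr_eq0. Qed.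

Lemma mean_share_le_oo k : h ord_max = +oo%E -> (k < N)%N ->
  mean_share k <= mean_share k.+1.
Proof.
move=> hN kN; rewrite /mean_share /tail_share hN eqxx (ltnW kN) kN.
rewrite !div1r lef_pV2 ?posrE ?ltr0n ?subn_gt0 ?ltnS //; last exact: ltnW.
by rewrite ler_nat leq_sub2l.
Qed.

Lemma mean_share_le k : admissible h -> (0 < k < N)%N ->
  mean_share k <= mean_share k.+1.
Proof.
move=> [_ adm]; case: k => // k /= kN.
have [hN|hN] := eqVneq (h ord_max) +oo%E.
  exact: mean_share_le_oo.
case: adm => [/eqP|adm]; first by rewrite (negPf hN).
have := adm (Ordinal (ltnW kN)) (Ordinal kN) (leqnSn k).
rewrite /mean_share /tail_share (negPf hN) /step_tail /= !subSS.
rewrite !(mulrAC _ S^-1) => le.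
by rewrite ler_pM2r // invr_gt0 step_sum_gt0.
Qed.

Lemma tail_share_le k l : (k <= l)%N -> tail_share l <= tail_share k.
Proof.
move=> kl; rewrite /tail_share; case: ifPn => hN.
  by rewrite ler_nat; case: (leqP l N) => // lN; rewrite (leq_trans kl lN).
rewrite ler_pM2r ?invr_gt0 ?step_sum_gt0 // big_mkcond [leRHS]big_mkcond /=.
apply: ler_sum => j _; case: ifPn => [lj|_]; first by rewrite (leq_trans kl lj).
by case: ifP => // _; exact: fine_step_ge0.
Qed.

End TailShares.

(** With p, q the mean shares at 1, 2, n = N + 1 and total length S, the two
    ratios are S (1 - (n+1) p) p and S ((n+1) p - n q) q.  The first exceeds
    S p^2 when 0 < p < 1/(n+2), and the second is at most S p^2 because
    (q - p) (n q - p) >= 0 for p <= q. *)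
Lemma first_mean_share_drop (K : realType) N (h : 'I_N.+3 -> \bar K) (alpha : 'I_N.+2 -> K) :
  admissible_for alpha h -> mean_share h 1 < mean_share h 0 ->
  tail_share h 1 = 0 \/
  alpha (lift ord0 ord0) / N.+1%:R < alpha ord0 / N.+2%:R.
Proof.
move=> [adm alphaE] lt10; have [sched _] := adm.
have hN : h ord_max != +oo%E.
  by apply: contraTneq lt10 => hN; rewrite -leNgt mean_share_le_oo.
have S0 := step_sum_gt0 sched hN; set S := \sum_i _ in S0.
have stepE k : fine (h k) = S * (tail_share h k - tail_share h k.+1).
  by rewrite -weightE /weight (negPf hN) mulrC divfK ?gt_eqF.
have [p0|p0] := eqVneq (mean_share h 1) 0.
  left; move/eqP: p0; rewrite /mean_share mulf_eq0 invr_eq0 pnatr_eq0 orbF.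
  by move/eqP.
right; rewrite -!alphaE !tail_ratioE !stepE (tail_share0 sched) /=.
have n0 : 0 < N.+1%:R :> K by rewrite ltr0n.
have := mean_share_le sched (k := 1) adm isT.
have := mean_share0 sched; have := mean_share_ge0 sched 1.
have r1 : tail_share h 1 = N.+2%:R * mean_share h 1.
  by rewrite /mean_share subSS subn0 mulrC divfK // pnatr_eq0.
have r2 : tail_share h 2 = N.+1%:R * mean_share h 2.
  by rewrite /mean_share !subSS subn0 mulrC divfK // pnatr_eq0.
rewrite (_ : bump 0 0 = 1%N) // r1 r2; move: lt10 p0.
move: (mean_share h 0) (mean_share h 1) (mean_share h 2) => s p q.
rewrite -[N.+3%:R]natr1 -[N.+2%:R]natr1.
have n1 : 1 <= N.+1%:R :> K by rewrite ler1n.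
move: (N.+1%:R : K) n0 n1 => n n0 n1 ps p_neq0 p_ge0 sE pq.
have p_gt0 : 0 < p by rewrite lt_def p_neq0.
have -> : S * ((n + 1) * p - n * q) * (n * q) / n = S * (((n + 1) * p - n * q) * q).
  by field; rewrite gt_eqF.
have -> : S * (1 - (n + 1) * p) * ((n + 1) * p) / (n + 1) = S * ((1 - (n + 1) * p) * p).
  by field; rewrite gt_eqF // addr_gt0.
rewrite ltr_pM2l //.
have h1 : p * p < (1 - (n + 1) * p) * p.
  rewrite ltr_pM2r //.
  have : (n + 2) * p < (n + 2) * s by rewrite ltr_pM2l // addr_gt0.
  have : (n + 2) * s = 1 by rewrite -[RHS]sE; ring.
  lra.
have h2 : 0 <= (q - p) * (n * q - p).
  apply: mulr_ge0; rewrite subr_ge0 //.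
  exact: le_trans pq (ler_peMl (le_trans p_ge0 pq) n1).
apply: le_lt_trans h1; rewrite -subr_ge0; move: h2; congr (0 <= _); ring.
Qed.

(** * The rate of the method *)

(** Admissibility leaves out the comparison of the first two mean shares, which
    comes from optimality; in the exceptional first case the output is the
    starting point. *)
Lemma mean_share_nondecreasing (K : realType) N (L R sigma : K) (alpha : 'I_N -> K)
    tau nus nu (h : 'I_N.+1 -> \bar K) :
  0 < L -> 0 < R -> optimal L R sigma alpha tau nus nu ->
  admissible_for alpha h ->
  tail_share h 1 = 0 \/
  (forall i, (i.+1 < N)%N -> mean_share h i <= mean_share h i.+1).
Proof.
move=> L0 R0 opt hP; have [adm _] := hP; have [sched _] := adm.
case: N alpha nu h opt hP adm sched => [|[|N]] alpha nu h opt hP adm sched.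
- by right.
- by right.
have [lt10|le01] := ltP (mean_share h 1) (mean_share h 0).
  have [|lt] := first_mean_share_drop hP lt10; first by left.
  by have := optimal_coupling_le L0 R0 opt; rewrite leNgt lt.
right=> -[//|i] iN; apply: mean_share_le => //; exact: ltnW.
Qed.

Section Subgradients.
Context {K : realType} {X : completeNormedModType K}.
Variable dot : {dot X for idfun}.

Lemma method_outputE N (h : 'I_N.+1 -> \bar K) (x : 'I_N.+1 -> X) (v : X) :
  schedule h ->
  dot v (method_output h x) = dot v (x ord_max) +
    \sum_(i < N) (tail_share h i - tail_share h i.+1) *
      (dot v (x (inord i)) - dot v (x ord_max)).
Proof.
move=> sched.
have wsum : \sum_(k < N.+1) weight h k = 1.
  rewrite (eq_bigr (fun k : 'I_N.+1 => - (tail_share h k.+1 - tail_share h k))).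
    rewrite sumrN -(big_mkord xpredT (fun k => tail_share h k.+1 - tail_share h k)).
    rewrite telescope_sumr // opprB tail_share0 // /tail_share ltnn.
    by case: ifP => _; rewrite ?subr0 // big_pred0 ?mul0r ?subr0 // => j; rewrite leqNgt ltn_ord.
  by move=> k _; rewrite weightE opprB.
have -> : dot v (method_output h x) = \sum_(k < N.+1) weight h k * dot v (x k).
  rewrite /method_output linear_sumr; apply: eq_bigr => k _.
  by rewrite linearZr_LR.
rewrite -[X in _ = X + _]mul1r -wsum mulr_suml.
apply/eqP; rewrite addrC -subr_eq -sumrB big_ord_recr /= subrr addr0.
apply/eqP; apply: eq_bigr => i _; rewrite weightE /=.
rewrite (_ : inord i = widen_ord (leqnSn N) i) ?mulrBr //.
by apply: val_inj; rewrite /= inordK // (leqW (ltn_ord i)).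
Qed.

End Subgradients.

Theorem corollary1 (K : realType) (X : completeNormedModType K)
    (dot : {dot X for idfun}) (dotE : induces_norm dot) (x0 : X)
    (N : nat) (N_ge1 : (1 <= N)%N)
    (L R gamma : K) (L_gt0 : 0 < L) (R_gt0 : 0 < R) (gamma_ge0 : 0 <= gamma)
    (alpha : 'I_N -> K) (tau nus : K) (nu : 'I_N.+1 -> K)
    (opt : optimal L R (gamma / L) alpha tau nus nu)
    (h : 'I_N.+1 -> \bar K) (hP : admissible_for alpha h)
    (f : X -> K) (fP : function_class dot x0 L R f)
    (xs : X) (xsP : minimizer f xs)
    (g e : 'I_N -> X) (x : 'I_N.+1 -> X)
    (xP : subgradient_method dot f x0 h g e x)
    (eP : \sum_(k < N) `|e k| ^+ 2 <= gamma ^+ 2) :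
  f (method_output h x) - f xs
    <= R * L / Num.sqrt N.+1%:R * uS N L R (gamma / L).
Proof.
have [feas best] := opt.
have -> : R * L / Num.sqrt N.+1%:R * uS N L R (gamma / L) = R * L *
    inf [set v | exists (alpha : 'I_N -> K) tau nus nu,
         feasible L R alpha tau nus nu /\ v = objective (gamma / L) tau nus nu]%classic.
  by rewrite /uS mulrA divfK // gt_eqF // sqrtr_gt0.
apply: (@le_trans _ _ (R * L * objective (gamma / L) tau nus nu)); last first.
  rewrite ler_wpM2l ?mulr_ge0 ?(ltW L_gt0) ?(ltW R_gt0) //.
  apply: lb_le_inf; first by exists (objective (gamma / L) tau nus nu), alpha, tau, nus, nu.
  by move=> v [alpha' [tau' [nus' [nu' [feas' ->]]]]]; exact: best feas'.
have [_ sub_ex sub_le [xs' xs'P xs'R]] := fP.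
have -> : f xs = f xs' by apply: le_anti; rewrite xsP xs'P.
have dR : `|x0 - xs'| <= R by rewrite distrC.
have [[sched adm] alphaE] := hP; have [x0E step] := xP.
set z := method_output h x.
have [gz gzP] := sub_ex z.
have subE y v : subdifferential dot f y v -> forall w, f y + (dot v w - dot v y) <= f w.
  by move=> vP w; rewrite -linearBr; exact: vP.
have [degenerate|s_incr] := mean_share_nondecreasing L_gt0 R_gt0 opt hP.
  (* Here z = x0 and alpha = 0: all rows of the certificate may be taken equal
     to gz, and all errors equal to 0. *)
  have share0 k : tail_share h k.+1 = 0.
    apply: le_anti; rewrite tail_share_ge0 // andbT -degenerate.
    exact: tail_share_le.
  have zE : z = x0.
    rewrite /z /method_output big_ord_recl big1 => [|k _].
      by rewrite addr0 weightE tail_share0 // share0 subr0 scale1r x0E.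
    by rewrite weightE lift0 !share0 subrr scale0r.
  have alpha0 j : alpha j = 0 by rewrite -alphaE tail_ratioE share0 mulr0.
  have e0 : \sum_(j < N) `|(fun=> 0 : X) j| ^+ 2 <= gamma ^+ 2.
    by rewrite big1 ?sqr_ge0 // => j _; rewrite normr0 expr0n.
  apply: le_trans (certificate_bound dotE L_gt0 R_gt0 feas dR (fun=> sub_le _ _ gzP) e0).
  rewrite [X in _ <= _ - X]big1 ?subr0 => [|j _]; last first.
    by rewrite big1 // => k _; rewrite alpha0 !mul0r.
  rewrite sumr_const card_ord -[X in _ * X]mulr_natl mulKf ?pnatr_eq0 //.
  have := subE _ _ gzP xs'; rewrite zE [dot (x0 - xs') _]dot_sym linearBr /=; lra.
pose wid := widen_ord (leqnSn N).
(* [insub] fails exactly at k = N, where the row of the certificate is gz. *)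
pose G (k : 'I_N.+1) := oapp g gz (insub (val k)).
have Gwid k : G (wid k) = g k.
  by rewrite /G insubT /= ?ltn_ord // => kN; congr g; exact: val_inj.
have Gmax : G ord_max = gz by rewrite /G insubN //= ltnn.
have GL k : `|G k| <= L.
  rewrite /G; case: insub => [j|] /=; last exact: sub_le gzP.
  by have [+ _] := step j; exact: sub_le.
apply: le_trans (certificate_bound dotE L_gt0 R_gt0 feas dR GL eP).
pose xn (i : nat) : X := x (inord i).
pose Gn (k : nat) : X := G (inord k).
have inord_wid (k : 'I_N) : inord k = wid k :> 'I_N.+1.
  by apply: val_inj; rewrite /= inordK // (leqW (ltn_ord k)).
have xnN : xn N = x ord_max.
  by congr x; apply: val_inj; rewrite /= inordK.
have GnN : Gn N = gz.
  by rewrite /Gn -Gmax; congr G; apply: val_inj; rewrite /= inordK.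
have xstep (j : 'I_N) : xn j - xn j.+1 = fine (h (wid j)) *: (g j + e j).
  have -> : xn j.+1 = x (lift ord0 j).
    by congr x; apply: val_inj; rewrite /= inordK ?ltnS // ltn_ord.
  have [_ ->] := step j; rewrite /xn inord_wid; exact: subKr.
have gsub (k : nat) : (k < N)%N -> subdifferential dot f (xn k) (Gn k).
  move=> kN; have [+ _] := step (Ordinal kN).
  by rewrite /xn /Gn -[k]/(val (Ordinal kN)) inord_wid Gwid.
have tw k : (k <= N)%N -> tail_weight N (mean_share h) k = tail_share h k.
  exact: tail_weight_mean_share.
have core := @weighted_subgradient_bound _ N (mean_share h) (f \o xn) (f z) (f xs')
  (fun k i => dot (Gn k) (xn i)) (fun k => dot (Gn k) xs') (dot gz z).
apply: le_trans (core _ _ _ _ _ _ _ _ _) _.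
- exact: mean_share0.
- by move=> i _; exact: mean_share_ge0.
- exact: s_incr.
- move=> i iN; rewrite !tw // ?(ltnW iN) //; exact: tail_share_le.
- rewrite /z method_outputE // xnN GnN; congr (_ + _); apply: eq_bigr => i _.
  by rewrite !tw // ?(ltnW (ltn_ord i)).
- by move=> k kN; exact: subE (gsub k kN) xs'.
- by move=> i k kN; exact: subE (gsub k kN) (xn i).
- by rewrite GnN; exact: subE gzP xs'.
- by move=> i; rewrite GnN; exact: subE gzP (xn i).
have s0E : mean_share h 0 = N.+1%:R^-1.
  by rewrite /mean_share tail_share0 // subn0 div1r.
have GnE (k : 'I_N.+1) : Gn k = G k by rewrite /Gn inord_val.
rewrite sumrB lerB //.
  rewrite mulr_sumr; apply: ler_sum => k _; rewrite s0E GnE.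
  rewrite (_ : xn 0%N = x0) -?linearBr 1?dot_sym // -x0E.
  by congr x; apply: val_inj; rewrite /= inordK.
rewrite [leLHS](exchange_big_dep predT) //=; apply: ler_sum => k _.
rewrite (big_ord_widen N (fun j => mean_share h j.+1 *
   (dot (Gn k) (xn j) - dot (Gn k) (xn j.+1)))) -1?ltnS //.
apply: ler_sum => j jk.
rewrite -linearBr xstep GnE Gwid linearZr_LR /= [dot (G k) _]dot_sym mulrA.
rewrite -alphaE tail_ratioE /mean_share subSS.
by rewrite [_ / _ * fine _]mulrC mulrA.
Qed.
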